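(* Let $m \in \mathbb{N}^*$. For every $n \in \mathbb{N}$ with $n \geq 1$, $$\sum_{N_m=1}^{n}\cdots \sum_{N_1=1}^{N_2} 1=\binom{n+m-1}{m},$$ and for every $n \in \mathbb{N}$, $$\sum_{N_m=0}^{n}\cdots \sum_{N_1=0}^{N_2} 1=\binom{n+m}{m}.$$
   Context: $\mathbb{N}=\{0,1,2,\dots\}$ and $\mathbb{N}^*=\{1,2,\dots\}$. The notation $\sum_{N_m=q}^{n}\cdots\sum_{N_1=q}^{N_2} f(N_1)$ denotes an $m$-fold nested sum: with $N_{m+1}:=n$, the index $N_j$ runs from $q$ to $N_{j+1}$ for $j=m,m-1,\dots,1$; for $m=1$ it is $\sum_{N_1=q}^{n}f(N_1)$. *)

(* Defs.v *)
From mathcomp Require Import all_boot.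

Set Implicit Arguments.
Unset Strict Implicit.
Unset Printing Implicit Defensive.

(* nested_sum q f m n is
     \sum_{N_m = q}^{n} \sum_{N_(m-1) = q}^{N_m} ... \sum_{N_1 = q}^{N_2} f N_1:
   each step of the recursion peels off the outermost index N_m, whose value
   becomes the upper bound of the next sum. Upper bounds are inclusive, hence
   the n.+1. The value f n at m = 0 makes m = 1 the plain sum of f from q to
   n. *)
Fixpoint nested_sum (q : nat) (f : nat -> nat) (m n : nat) : nat :=
  if m is m'.+1 then \sum_(q <= N < n.+1) nested_sum q f m' N else f n.

(* Main.v *)
Require Import Defs.
From mathcomp Require Import all_boot.

(** Let S(m, n) be the m-fold nested sum of 1 whose indices start at 0 and whose
    outermost bound is n.  Splitting off the last term of the outermost sum gives
    S(m+1, n+1) = S(m+1, n) + S(m, n+1), which is Pascal's rule for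
    S(m, n) = 'C(n + m, m) ([nested_sum0_const1]).  A nested sum starting at 1
    with upper bound n becomes one starting at 0 with upper bound n - 1 when
    every index is lowered by one ([nested_sum_shift]), so the identity for sums
    starting at 1 follows from the one for sums starting at 0. *)

(** All the indices N_1, ..., N_m are lowered together: each is the upper bound
    of the next sum, so shifting one bound shifts the whole chain, and only the
    innermost summand records the change. *)
Lemma nested_sum_shift (q : nat) (f : nat -> nat) (m n : nat) :
  nested_sum q.+1 f m n.+1 = nested_sum q (fun k => f k.+1) m n.
Proof.
elim: m n => [|m IHm] n //=.
by rewrite big_add1; apply: eq_bigr => i _; apply: IHm.
Qed.

(** At n = 0 every index is forced to be 0, leaving a single term; the step in n
    is Pascal's rule. *)
Lemma nested_sum0_const1 (m n : nat) :
  nested_sum 0 (fun _ => 1) m n = 'C(n + m, m).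
Proof.
elim: m n => [|m IHm] n /=; first by rewrite bin0.
elim: n => [|n IHn]; first by rewrite big_nat1 IHm !add0n !binn.
by rewrite big_nat_recr //= IHn IHm !addnS addSn binS.
Qed.

Theorem theorem3p1 (m : nat) (hm : 1 <= m) :
  (forall n : nat, 1 <= n -> nested_sum 1 (fun _ => 1) m n = 'C(n + m - 1, m))
  /\ (forall n : nat, nested_sum 0 (fun _ => 1) m n = 'C(n + m, m)).
Proof.
split=> [[//|n] _|n]; last exact: nested_sum0_const1.
by rewrite nested_sum_shift nested_sum0_const1 addSn subn1.
Qed.
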